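(* In the setting of the context, let $\lambda_0=\inf\{D(f):f\in\mathscr K,\ \|f\|=1\}$ and $$\delta=\sup_{n\in E}\Big(\sum_{j=0}^n\mu_j\Big)\Big(\sum_{k=n}^N\frac1{b_k\mu_k}\Big).$$ Then $\lambda_0>0$ if and only if $\delta<\infty$. More precisely, $(4\delta)^{-1}\le\lambda_0\le\delta^{-1}$. In particular, when $N=\infty$, we have $\lambda_0=0$ if the process is recurrent (i.e. $\sum_{k\ge1}\frac1{\mu_kb_k}=\infty$), and $\lambda_0>0$ if the process is explosive (i.e. $\sum_{k=0}^\infty\frac1{b_k\mu_k}\sum_{i=0}^k\mu_i<\infty$).
   Context: Fix $1\le N\le\infty$ and $E=\{k\in\mathbb Z:0\le k<N+1\}$. Birth rates $b_i>0$ for all $i\in E$ (in particular $b_N>0$ if $N<\infty$), death rates $a_i>0$ for $1\le i\in E$, $a_0=0$. $\mu_0=1$, $\mu_n=\frac{b_0\cdots b_{n-1}}{a_1\cdots a_n}$. $\|\cdot\|$ is the norm of $L^2(\mu)$; $\mathscr K$ is the set of finitely supported functions on $E$; $D(f)=\sum_{i\in E}\mu_ib_i(f_{i+1}-f_i)^2$ with $f_{N+1}:=0$ if $N<\infty$ (Dirichlet boundary at $N+1$). Convention $1/\infty=0$. *)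

(* Defs.v *)
From HB Require Import structures.
From mathcomp Require Export all_boot all_order all_algebra.
From mathcomp Require Export all_classical all_reals all_analysis.

Set Implicit Arguments.
Unset Strict Implicit.
Unset Printing Implicit Defensive.

Import Order.TTheory GRing.Theory Num.Theory.

Local Open Scope classical_set_scope.
Local Open Scope ring_scope.

(* The upper end N of the state space is an [option nat], [None] standing for
   infinity. *)
Definition states (N : option nat) : set nat :=
  [set k | if N is Some n then (k < n.+1)%N else true].

(* Rates are indexed by all of [nat]; only their values on [states N] are
   constrained. *)
Definition bd_rates (R : realType) (N : option nat) (a b : nat -> R) : Prop :=
  [/\ forall i, states N i -> 0 < b i,
      forall i, states N i -> (1 <= i)%N -> 0 < a i
    & a 0%N = 0].

Definition mu (R : realType) (a b : nat -> R) (n : nat) : R :=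
  (\prod_(0 <= i < n) b i) / (\prod_(1 <= i < n.+1) a i).

(* Finitely supported functions on [states N], each one represented by its extension by
   zero to [nat]; for finite N this includes the boundary value f_(N+1) = 0. *)
Definition fin_supp (R : realType) (N : option nat) : set (nat -> R) :=
  [set f | finite_set [set i | f i != 0] /\ [set i | f i != 0] `<=` states N].

Definition L2norm (R : realType) (N : option nat) (a b : nat -> R)
    (f : nat -> R) : \bar R :=
  sqrte (\esum_(i in states N) (mu a b i * f i ^+ 2)%:E).

Definition dirichlet (R : realType) (N : option nat) (a b : nat -> R)
    (f : nat -> R) : \bar R :=
  \esum_(i in states N) (mu a b i * b i * (f i.+1 - f i) ^+ 2)%:E.

Definition lambda0 (R : realType) (N : option nat) (a b : nat -> R) : \bar R :=
  ereal_inf [set dirichlet N a b f | f in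
    [set f | fin_supp N f /\ L2norm N a b f = 1%E]].

Definition delta (R : realType) (N : option nat) (a b : nat -> R) : \bar R :=
  ereal_sup [set ((\sum_(0 <= j < n.+1) mu a b j)%:E *
      \esum_(k in [set k | states N k /\ (n <= k)%N])
        ((b k * mu a b k)^-1)%:E)%E | n in states N].

(* The next two notions are for N infinite. *)
Definition recurrent (R : realType) (a b : nat -> R) : Prop :=
  (\sum_(1 <= k <oo) ((mu a b k * b k)^-1)%:E = +oo)%E.

Definition explosive (R : realType) (a b : nat -> R) : Prop :=
  (\sum_(0 <= k <oo)
     ((b k * mu a b k)^-1 * \sum_(0 <= i < k.+1) mu a b i)%:E < +oo)%E.

(* Main.v *)
Require Import Defs.
From mathcomp Require Import ring lra.
Import Order.TTheory GRing.Theory Num.Theory.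

(* Both bounds reduce to functions living on a finite initial segment {0, .., M}
   of the state space.  Put A_k = mu_0 + .. + mu_k and
   B_k = 1/(b_k mu_k) + .. + 1/(b_M mu_M).
   Lower bound: writing f_i as a sum of increments and applying Cauchy-Schwarz
   with weights mu_k b_k sqrt(B_k), the sum of the (B_k - B_(k+1)) / sqrt(B_k)
   for k >= i is at most 2 sqrt(B_i) by telescoping.  After exchanging the sums,
   sqrt(B_i) <= sqrt(delta / A_i) and a second telescoping, now of
   (A_i - A_(i-1)) / sqrt(A_i), give the constant 4 delta.
   Upper bound: the function i |-> B_(max(i,n)) has energy B_n and squared
   norm at least A_n B_n ^ 2. *)

Local Open Scope classical_set_scope.
Local Open Scope ring_scope.

(** * Telescoping, Cauchy-Schwarz and a weighted Hardy inequality on finite segments *)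

(** Factor x - y as (sqrt x - sqrt y) (sqrt x + sqrt y) and bound the second factor by 2 sqrt x.
    This is the source of both factors 2 in the constant 4. *)
Lemma sqrt_increment (R : rcfType) (x y : R) : 0 <= y -> y <= x -> 0 < x ->
  (x - y) / Num.sqrt x <= 2 * (Num.sqrt x - Num.sqrt y).
Proof.
move=> y0 yx x0.
have sx0 : 0 < Num.sqrt x by rewrite sqrtr_gt0.
have syx : Num.sqrt y <= Num.sqrt x by rewrite ler_wsqrtr.
rewrite ler_pdivrMr// -{1}(sqr_sqrtr (ltW x0)) -{1}(sqr_sqrtr y0).
have := sqrtr_ge0 y; nra.
Qed.

Lemma sum_div_sqrt_head (R : rcfType) (m : nat -> R) (n : nat) :
  (forall i, (i < n)%N -> 0 < m i) ->
  \sum_(0 <= i < n) m i / Num.sqrt (\sum_(0 <= j < i.+1) m j) <=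
  2 * Num.sqrt (\sum_(0 <= j < n) m j).
Proof.
move=> m0; pose A i := \sum_(0 <= j < i) m j.
have A0 i : (i <= n)%N -> 0 <= A i.
  move=> le_in; rewrite /A big_nat; apply: sumr_ge0 => j /andP[_ ji].
  by apply/ltW/m0/(leq_trans ji).
have -> : 2 * Num.sqrt (A n) =
    \sum_(0 <= i < n) (2 * Num.sqrt (A i.+1) - 2 * Num.sqrt (A i)).
  by rewrite telescope_sumr// {3}/A big_geq// sqrtr0 mulr0 subr0.
apply: ler_sum_nat => i /andP[_ lt_in].
have AS : A i.+1 = A i + m i by rewrite /A big_nat_recr.
have mi := m0 _ lt_in; have Ai := A0 _ (ltnW lt_in).
rewrite -/(A _) -mulrBr; have -> : m i = A i.+1 - A i by rewrite AS; ring.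
by apply: sqrt_increment; rewrite ?AS; lra.
Qed.

Lemma sum_div_sqrt_tail (R : rcfType) (v : nat -> R) (n k : nat) :
  (forall i, (i < n)%N -> 0 < v i) -> (k <= n)%N ->
  \sum_(k <= i < n) v i / Num.sqrt (\sum_(i <= j < n) v j) <=
  2 * Num.sqrt (\sum_(k <= j < n) v j).
Proof.
move=> v0 kn; pose B i := \sum_(i <= j < n) v j.
have B0 i : 0 <= B i.
  rewrite /B big_nat; apply: sumr_ge0 => j /andP[_ jn].
  exact/ltW/v0.
(* B decreases in its index, hence the signs in the telescoping sum; the upper end contributes
   nothing because B n is an empty sum. *)
have -> : 2 * Num.sqrt (B k) =
    \sum_(k <= i < n) (- (2 * Num.sqrt (B i.+1)) - - (2 * Num.sqrt (B i))).
  rewrite (telescope_sumr (fun i => - (2 * Num.sqrt (B i))))//.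
  by rewrite {2}/B big_geq// sqrtr0 mulr0; ring.
apply: ler_sum_nat => i /andP[_ lt_in].
have BS : B i = v i + B i.+1 by rewrite /B big_ltn.
have vi := v0 _ lt_in; have Bi := B0 i.+1.
rewrite -/(B _) opprK addrC -mulrBr.
have -> : v i = B i - B i.+1 by rewrite BS; ring.
by apply: sqrt_increment; rewrite ?BS; lra.
Qed.

Lemma weighted_cauchy_schwarz (R : realFieldType) (I : Type) (r : seq I)
    (P : pred I) (p g : I -> R) : (forall i, P i -> 0 < p i) ->
  (\sum_(i <- r | P i) g i) ^+ 2 <=
  (\sum_(i <- r | P i) (p i)^-1) * (\sum_(i <- r | P i) p i * g i ^+ 2).
Proof.
move=> p0; elim: r => [|i r IHr]; first by rewrite !big_nil expr0n mul0r.
rewrite !big_cons; case: ifPn => // Pi.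
set S := \sum_(_ <- _ | _) _ in IHr *.
set X := \sum_(_ <- _ | _) _ in IHr *.
set Y := \sum_(_ <- _ | _) _ in IHr *.
have X0 : 0 <= X by apply: sumr_ge0 => j Pj; rewrite invr_ge0 ltW ?p0.
have Y0 : 0 <= Y.
  by apply: sumr_ge0 => j Pj; rewrite mulr_ge0 ?sqr_ge0// ltW ?p0.
have pi := p0 _ Pi.
(* Only the cross terms remain: with S ^ 2 <= X Y, the claim is the arithmetic-geometric mean
   inequality for Y / p_i and X p_i g_i ^ 2. *)
suff : 2 * (S * g i) <= (p i)^-1 * Y + X * (p i * g i ^+ 2).
  have -> : ((p i)^-1 + X) * (p i * g i ^+ 2 + Y) =
      g i ^+ 2 + X * Y + ((p i)^-1 * Y + X * (p i * g i ^+ 2)).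
    by field; rewrite gt_eqF.
  have -> : (g i + S) ^+ 2 = g i ^+ 2 + S ^+ 2 + 2 * (S * g i) by ring.
  by lra.
rewrite -(ler_pM2l pi).
have -> : p i * ((p i)^-1 * Y + X * (p i * g i ^+ 2)) =
    Y + X * (p i * g i) ^+ 2.
  by field; rewrite gt_eqF.
have -> : p i * (2 * (S * g i)) = 2 * S * (p i * g i) by ring.
set t := p i * g i.
have [S0|S0] := leP (2 * S * t) 0.
  by apply: (le_trans S0); rewrite addr_ge0// mulr_ge0// sqr_ge0.
have T0 : 0 <= Y + X * t ^+ 2 by rewrite addr_ge0// mulr_ge0// sqr_ge0.
(* Square roots of X and Y need not exist in a [realFieldType], so the squares of the two sides are
   compared. *)
suff : (2 * S * t) ^+ 2 <= (Y + X * t ^+ 2) ^+ 2.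
  by rewrite ler_pXn2r ?nnegrE ?(ltW S0).
rewrite -subr_ge0.
have XY : S ^+ 2 * t ^+ 2 <= X * Y * t ^+ 2 by rewrite ler_wpM2r ?sqr_ge0.
have -> : (Y + X * t ^+ 2) ^+ 2 - (2 * S * t) ^+ 2 =
  (Y - X * t ^+ 2) ^+ 2 + 4 * (X * Y * t ^+ 2 - S ^+ 2 * t ^+ 2) by ring.
by rewrite addr_ge0 ?sqr_ge0// mulr_ge0// subr_ge0.
Qed.

Lemma sum_triangle_exchange (R : nmodType) (F : nat -> nat -> R) (n : nat) :
  \sum_(0 <= i < n) \sum_(i <= k < n) F i k =
  \sum_(0 <= k < n) \sum_(0 <= i < k.+1) F i k.
Proof.
under eq_bigr do rewrite (big_nat_widenl _ 0)//.
rewrite (exchange_big_dep_nat xpredT)//=.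
apply: eq_big_nat => k /andP[_ kn].
by rewrite [RHS](big_nat_widen _ _ n).
Qed.

(** The boundary condition f_n = 0 makes f_i minus the sum of the later increments. Of the two
    factors sqrt d that make up d, one comes from the indices i <= k and the other from k itself. *)
Lemma hardy (R : rcfType) (m c f : nat -> R) (n : nat) (d : R) :
  (forall i, (i < n)%N -> 0 < m i) -> (forall i, (i < n)%N -> 0 < c i) ->
  (forall k, (k < n)%N ->
    (\sum_(0 <= j < k.+1) m j) * (\sum_(k <= j < n) (c j)^-1) <= d) ->
  f n = 0 ->
  \sum_(0 <= i < n) m i * f i ^+ 2 <=
  4 * d * \sum_(0 <= i < n) c i * (f i.+1 - f i) ^+ 2.
Proof.
move=> m0 c0 AB fn.
pose A i := \sum_(0 <= j < i.+1) m j; pose B i := \sum_(i <= j < n) (c j)^-1.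
have v0 i : (i < n)%N -> 0 < (c i)^-1 by move=> /c0; rewrite invr_gt0.
have A0 i : (i < n)%N -> 0 < A i.
  move=> lt_in; rewrite /A big_nat_recr//=; apply: ltr_wpDl; last exact: m0.
  rewrite big_nat; apply: sumr_ge0 => j /andP[_ ji].
  by apply/ltW/m0/(ltn_trans ji).
have B0 i : (i < n)%N -> 0 < B i.
  move=> lt_in; rewrite /B big_ltn//; apply: ltr_wpDr; last exact: v0.
  by rewrite big_nat; apply: sumr_ge0 => j /andP[_ ji]; exact/ltW/v0.
pose G k := c k * (f k.+1 - f k) ^+ 2.
have G0 k : (k < n)%N -> 0 <= G k.
  by move=> kn; rewrite mulr_ge0 ?sqr_ge0 ?ltW ?c0.
have f2 i : (i < n)%N ->
    f i ^+ 2 <= 2 * Num.sqrt (B i) * \sum_(i <= k < n) Num.sqrt (B k) * G k.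
  move=> lt_in.
  have -> : f i ^+ 2 = (\sum_(i <= k < n) (f k.+1 - f k)) ^+ 2.
    by rewrite telescope_sumr ?(ltnW lt_in)// fn; ring.
  rewrite big_nat_cond.
  (* With the weight c_k sqrt(B_k), the sum of the inverse weights is exactly the one bounded by
     [sum_div_sqrt_tail]. *)
  apply: le_trans (weighted_cauchy_schwarz _ _ _ _
    (fun k => c k * Num.sqrt (B k)) _ _) _.
    move=> k /andP[/andP[_ kn] _].
    by rewrite mulr_gt0 ?c0// sqrtr_gt0 B0.
  rewrite -!big_nat_cond; apply: ler_pM => //.
  - rewrite big_nat_cond; apply: sumr_ge0 => k /andP[/andP[_ kn] _].
    by rewrite invr_ge0 mulr_ge0 ?sqrtr_ge0// ltW ?c0.
  - rewrite big_nat_cond; apply: sumr_ge0 => k /andP[/andP[_ kn] _].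
    by rewrite mulr_ge0 ?sqr_ge0// mulr_ge0 ?sqrtr_ge0// ltW ?c0.
  - apply: le_trans (sum_div_sqrt_tail _ _ _ _ v0 (ltnW lt_in)).
    by apply: ler_sum_nat => k _; rewrite invfM.
  - by apply: ler_sum_nat => k _; rewrite /G [leRHS]mulrA (mulrC (c k)).
have step1 : \sum_(0 <= i < n) m i * f i ^+ 2 <=
   \sum_(0 <= i < n) \sum_(i <= k < n)
      m i * (2 * Num.sqrt (B i)) * (Num.sqrt (B k) * G k).
  apply: ler_sum_nat => i /andP[_ lt_in].
  by rewrite -mulr_sumr -mulrA ler_wpM2l ?f2// ltW ?m0.
(* After the exchange, it is enough to compare the coefficients of each G_k. *)
apply: (le_trans step1); rewrite sum_triangle_exchange mulr_sumr.
apply: ler_sum_nat => k /andP[_ kn]; rewrite -/(G k) -mulr_suml [leLHS]mulrA.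
rewrite ler_wpM2r ?G0//.
(* The sign of d comes from the index k at hand; for n = 0 nothing constrains d, but both sums are
   then empty. *)
have d0 : 0 <= d by apply: le_trans (AB _ kn); rewrite ltW// mulr_gt0 ?A0 ?B0.
have sAB i : (i < n)%N -> Num.sqrt (A i) * Num.sqrt (B i) <= Num.sqrt d.
  by move=> lt_in; rewrite -(sqrtrM _ (ltW (A0 _ lt_in))) ler_wsqrtr// AB.
have mB : \sum_(0 <= i < k.+1) m i * (2 * Num.sqrt (B i)) <=
    2 * Num.sqrt d * (2 * Num.sqrt (A k)).
  have lt_trans i : (i < k.+1)%N -> (i < n)%N by move=> /leq_trans; apply.
  apply: (@le_trans _ _ (2 * Num.sqrt d *
       \sum_(0 <= i < k.+1) m i / Num.sqrt (A i))); last first.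
    apply: ler_wpM2l; first by rewrite mulr_ge0// sqrtr_ge0.
    by apply: sum_div_sqrt_head => i /lt_trans /m0.
  rewrite mulr_sumr; apply: ler_sum_nat => i /andP[_ /lt_trans lt_in].
  have sA : 0 < Num.sqrt (A i) by rewrite sqrtr_gt0 A0.
  rewrite [leRHS]mulrA ler_pdivlMr//.
  have -> : m i * (2 * Num.sqrt (B i)) * Num.sqrt (A i) =
    2 * m i * (Num.sqrt (A i) * Num.sqrt (B i)) by ring.
  have -> : 2 * Num.sqrt d * m i = 2 * m i * Num.sqrt d by ring.
  by rewrite ler_wpM2l ?sAB// mulr_ge0// ltW ?m0.
(* The sqrt(A_k) left over by the head sum pairs with sqrt(B_k) to give the second factor sqrt d. *)
apply: (le_trans (ler_wpM2r (sqrtr_ge0 _) mB)).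
have -> : 2 * Num.sqrt d * (2 * Num.sqrt (A k)) * Num.sqrt (B k) =
  4 * Num.sqrt d * (Num.sqrt (A k) * Num.sqrt (B k)) by ring.
rewrite -{2}(sqr_sqrtr d0) expr2 [leRHS]mulrA.
by rewrite ler_wpM2l ?sAB// mulr_ge0// sqrtr_ge0.
Qed.

(** From k on, c_i (f_i - f_(i+1)) = 1, so the energy terms are 1 / c_i and add up to f_k. Up to k,
    f is constant: no energy there, and the mass of these indices alone gives the lower bound. *)
Lemma tail_test_function (R : realFieldType) (m c f : nat -> R) (n k : nat) :
  (forall i, (i < n)%N -> 0 < m i) -> (forall i, (i < n)%N -> 0 < c i) ->
  (k < n)%N -> (forall i, f i = \sum_(maxn i k <= j < n) (c j)^-1) ->
  (\sum_(0 <= j < k.+1) m j) * f k ^+ 2 <= \sum_(0 <= i < n) m i * f i ^+ 2 /\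
  \sum_(0 <= i < n) c i * (f i.+1 - f i) ^+ 2 = f k.
Proof.
move=> m0 c0 kn fE; split.
  rewrite [leRHS](big_cat_nat (n := k.+1))//= -[leLHS]addr0; apply: lerD.
    rewrite mulr_suml; apply: ler_sum_nat => i /andP[_ ik].
    by rewrite (fE i) (maxn_idPr _)// (fE k) maxnn.
  rewrite big_nat; apply: sumr_ge0 => i /andP[_ lt_in].
  by rewrite mulr_ge0 ?sqr_ge0// ltW ?m0.
rewrite (big_cat_nat (n := k))//= ?(ltnW kn)// big_nat big1 ?add0r; last first.
  move=> i /andP[_ ik]; rewrite !fE (maxn_idPr ik) (maxn_idPr (ltnW ik)).
  by rewrite subrr expr0n mulr0.
rewrite fE maxnn; apply: eq_big_nat => i /andP[ki lt_in].
rewrite !fE (maxn_idPl ki) (maxn_idPl (leqW ki)) [in X in _ - X]big_ltn//.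
by field; rewrite gt_eqF ?c0.
Qed.

(** * Sums over the state space and their finite truncations *)

Lemma esum_nat_trunc (R : realType) (S : set nat) (F : nat -> R) (n : nat) :
  (forall i, (i < n)%N -> S i) -> (forall i, (i < n)%N -> 0 <= F i) ->
  (forall i, (n <= i)%N -> F i = 0) ->
  \esum_(i in S) (F i)%:E = (\sum_(0 <= i < n) F i)%:E.
Proof.
move=> nS F0 Fn.
have F0' i : 0 <= F i by case: (ltnP i n) => [/F0//|/Fn ->].
rewrite esum_mkcond -nneseries_esumT; last first.
  by move=> i; case: ifP => // _; rewrite lee_fin.
rewrite (nneseries_split 0 n); last first.
  by move=> i _; case: ifP => // _; rewrite lee_fin.
rewrite add0n [X in (_ + X)%E]eseries0 ?adde0; last first.
  by move=> i ni _; rewrite Fn// if_same.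
rewrite -sumEFin; apply: eq_big_nat => i /andP[_ lt_in].
by rewrite mem_set//; apply: nS.
Qed.

Section states.
Variable N : option nat.

Lemma states_le (i j : nat) : states N j -> (i <= j)%N -> states N i.
Proof. by case: N => [n|]//= jn ij; apply: leq_ltn_trans jn. Qed.

(** This treats finite and infinite N uniformly: the witness is N itself when N is finite, and
    max(n, m) otherwise. *)
Lemma states_cofinal (n m : nat) : states N n ->
  exists M, [/\ states N M, (n <= M)%N &
    forall i, states N i -> (i < m)%N -> (i <= M)%N].
Proof.
case: N => [n0|] /= Nn.
  by exists n0; split => //= i; rewrite ltnS.
exists (maxn n m); split => //; first exact: leq_maxl.
by move=> i _ /ltnW im; rewrite leq_max im orbT.
Qed.

(** Written as a series over all of [nat] with a cutoff, a finite sum can be compared term by term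
    with a sum over states. *)
Lemma sum_window (R : realType) (v : nat -> R) (n M : nat) :
  (forall i, states N i -> 0 <= v i) -> states N M ->
  (\sum_(n <= k < M.+1) v k)%:E =
  (\sum_(0 <= k <oo) (if (n <= k < M.+1)%N then v k else 0)%:E)%E.
Proof.
move=> v0 NM; pose w k := if (n <= k < M.+1)%N then v k else 0.
have w0 k : 0 <= w k.
  by rewrite /w; case: ifP => // /andP[_ kM]; exact: v0 (states_le _ _ NM kM).
rewrite nneseries_esumT; last by move=> k; rewrite lee_fin w0.
rewrite (@esum_nat_trunc _ _ w M.+1)//; last first.
  by move=> i Mi; rewrite /w ltnNge Mi andbF.
congr EFin; rewrite (big_nat_widenl _ 0)// big_mkcond/=.
by apply: eq_big_nat => k /andP[_ kM]; rewrite /w kM andbT.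
Qed.

Lemma le_esum_tail (R : realType) (v : nat -> R) (n M : nat) :
  (forall i, states N i -> 0 <= v i) -> states N M ->
  ((\sum_(n <= k < M.+1) v k)%:E <=
   \esum_(k in [set k | states N k /\ (n <= k)%N]) (v k)%:E)%E.
Proof.
move=> v0 NM; rewrite sum_window// esum_mkcond nneseries_esumT; last first.
  move=> k; case: ifP => // /andP[_ kM]; rewrite lee_fin.
  exact: v0 (states_le _ _ NM kM).
apply: le_esum => i _; case: ifPn => [/andP[ni iM]|_].
  by rewrite mem_set//; split => //; exact: states_le NM iM.
by case: ifPn => // /set_mem[/v0]; rewrite lee_fin.
Qed.

Lemma esum_tail_le (R : realType) (v : nat -> R) (n : nat) (z : \bar R) :
  states N n -> (forall i, states N i -> 0 <= v i) ->
  (forall M, states N M -> (n <= M)%N ->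
     ((\sum_(n <= k < M.+1) v k)%:E <= z)%E) ->
  (\esum_(k in [set k | states N k /\ (n <= k)%N]) (v k)%:E <= z)%E.
Proof.
move=> Nn v0 vz; set S := [set k | _].
have w0 i : (0 <= if i \in S then (v i)%:E else 0)%E.
  by case: ifPn => // /set_mem[/v0]; rewrite lee_fin.
rewrite esum_mkcond -nneseries_esumT//.
apply: lime_le; first exact: is_cvg_nneseries.
apply: nearW => m; have [M [NM nM mM]] := states_cofinal _ m Nn.
apply: le_trans (vz _ NM nM); rewrite sum_window//.
apply: le_trans (nneseries_lim_ge m _); last first.
  move=> k _ _; case: ifP => // /andP[_ kM]; rewrite lee_fin.
  exact: v0 (states_le _ _ NM kM).
rewrite big_nat [leRHS]big_nat; apply: lee_sum => k /andP[_ km].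
case: ifPn => [/set_mem[Nk nk]|_]; first by rewrite nk ltnS mM.
case: ifP => // /andP[_ kM]; rewrite lee_fin.
exact: v0 (states_le _ _ NM kM).
Qed.
End states.

(** * The two bounds for the birth-death process *)

Section birth_death.
Variables (R : realType) (N : option nat) (a b : nat -> R).
Hypothesis rates : bd_rates N a b.

Lemma mu_gt0 (n : nat) : states N n -> 0 < mu a b n.
Proof.
have [b0 a0 _] := rates; move=> Nn; apply: divr_gt0.
  rewrite big_nat; apply: prodr_gt0 => i /andP[_ lt_in].
  by apply: b0; apply: states_le Nn (ltnW lt_in).
rewrite big_nat; apply: prodr_gt0 => i /andP[i0 lt_in].
by apply: a0 => //; apply: states_le Nn lt_in.
Qed.

Lemma rate_gt0 (n : nat) : states N n -> 0 < mu a b n * b n.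
Proof. by have [b0 _ _] := rates; move=> Nn; rewrite mulr_gt0 ?mu_gt0 ?b0. Qed.

Definition mass (f : nat -> R) (M : nat) : R :=
  \sum_(0 <= i < M.+1) mu a b i * f i ^+ 2.

(** The last term involves f_(M+1), which vanishes wherever f is supported in {0, .., M}; for M = N
    it is the Dirichlet boundary term. *)
Definition energy (f : nat -> R) (M : nat) : R :=
  \sum_(0 <= i < M.+1) mu a b i * b i * (f i.+1 - f i) ^+ 2.

Lemma dirichlet_trunc (f : nat -> R) (M : nat) :
  states N M -> (forall i, (M < i)%N -> f i = 0) ->
  dirichlet N a b f = (energy f M)%:E.
Proof.
move=> NM fM; apply: esum_nat_trunc => i iM.
- exact: states_le NM iM.
- by rewrite mulr_ge0 ?sqr_ge0// ltW ?rate_gt0//; exact: states_le NM iM.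
- by rewrite !fM// ?(leqW iM)// subrr expr0n mulr0.
Qed.

Lemma L2norm_trunc (f : nat -> R) (M : nat) :
  states N M -> (forall i, (M < i)%N -> f i = 0) ->
  L2norm N a b f = (Num.sqrt (mass f M))%:E.
Proof.
move=> NM fM; rewrite /L2norm (@esum_nat_trunc _ _ _ M.+1)// => i iM.
- exact: states_le NM iM.
- by rewrite mulr_ge0 ?sqr_ge0// ltW ?mu_gt0//; exact: states_le NM iM.
- by rewrite !fM// expr0n mulr0.
Qed.

Lemma mass_ge0 (f : nat -> R) (M : nat) : states N M -> 0 <= mass f M.
Proof.
move=> NM; rewrite /mass big_nat; apply: sumr_ge0 => i /andP[_ iM].
by rewrite mulr_ge0 ?sqr_ge0// ltW ?mu_gt0//; exact: states_le NM iM.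
Qed.

Lemma energy_ge0 (f : nat -> R) (M : nat) : states N M -> 0 <= energy f M.
Proof.
move=> NM; rewrite /energy big_nat; apply: sumr_ge0 => i /andP[_ iM].
by rewrite mulr_ge0 ?sqr_ge0// ltW ?rate_gt0//; exact: states_le NM iM.
Qed.

Lemma fin_supp_trunc (f : nat -> R) : fin_supp N f ->
  exists2 M, states N M & forall i, (M < i)%N -> f i = 0.
Proof.
move=> [/finite_seqP[s fs] fN].
have N0 : states N 0 by case: N.
(* The bound is one more than the largest index in the support. *)
have [M [NM _ sM]] := states_cofinal _ _ (\max_(i <- s) i).+1 N0.
exists M => // i Mi; apply/eqP/negPn/negP => fi0.
have si : i \in s by have : [set` s] i by rewrite -fs.
move: Mi; apply/negP; rewrite -leqNgt; apply: sM; first exact: fN.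
by rewrite ltnS; apply: (leq_bigmax_seq (F := id)).
Qed.

(** The competitor is f divided by its norm; this passes from the constrained infimum to Rayleigh
    quotients. *)
Lemma lambda0_le (f : nat -> R) (M : nat) :
  states N M -> (forall i, (M < i)%N -> f i = 0) -> 0 < mass f M ->
  (lambda0 N a b <= (energy f M / mass f M)%:E)%E.
Proof.
move=> NM fM m0; pose g i := f i / Num.sqrt (mass f M).
have gM i : (M < i)%N -> g i = 0 by move=> Mi; rewrite /g fM// mul0r.
have sq2 : Num.sqrt (mass f M) ^+ 2 = mass f M by rewrite sqr_sqrtr// ltW.
have mg : mass g M = 1.
  rewrite -(divff (lt0r_neq0 m0)) {2}/mass mulr_suml.
  by apply: eq_bigr => i _; rewrite /g expr_div_n sq2 mulrA.
have eg : energy g M = energy f M / mass f M.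
  rewrite /energy mulr_suml.
  by apply: eq_bigr => i _; rewrite /g -mulrBl expr_div_n sq2 mulrA.
apply: ereal_inf_lbound.
exists g; last by rewrite (dirichlet_trunc _ _ NM gM) eg.
split; last by rewrite (L2norm_trunc _ _ NM gM) mg sqrtr1.
have gi i : g i != 0 -> (i <= M)%N.
  by rewrite leqNgt => gi0; apply/negP => /gM gi; rewrite gi eqxx in gi0.
split; last by move=> i /gi; exact: states_le NM.
by apply: (sub_finite_set _ (finite_II M.+1)) => i /gi.
Qed.

Lemma le_lambda0 (r : R) :
  (forall f M, states N M -> (forall i, (M < i)%N -> f i = 0) ->
     r * mass f M <= energy f M) ->
  (r%:E <= lambda0 N a b)%E.
Proof.
move=> rf; apply: le_ereal_inf_tmp => _ [f [fs nf] <-].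
have [M NM fM] := fin_supp_trunc _ fs.
rewrite (dirichlet_trunc _ _ NM fM) lee_fin.
move: nf; rewrite (L2norm_trunc _ _ NM fM) => -[s1].
have m1 : mass f M = 1 by rewrite -(sqr_sqrtr (mass_ge0 _ _ NM)) s1 expr1n.
by have := rf _ _ NM fM; rewrite m1 mulr1.
Qed.

Definition head_mass (n : nat) : R := \sum_(0 <= j < n.+1) mu a b j.

(** In the electrical picture, where the edge from k to k+1 has conductance mu_k b_k, this is the
    series resistance between n and M+1. *)
Definition tail_resistance (n M : nat) : R :=
  \sum_(n <= k < M.+1) (b k * mu a b k)^-1.

Lemma resistance_gt0 (k : nat) : states N k -> 0 < (b k * mu a b k)^-1.
Proof. by move=> Nk; rewrite invr_gt0 mulrC rate_gt0. Qed.

Lemma head_mass_gt0 (n : nat) : states N n -> 0 < head_mass n.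
Proof.
move=> Nn; rewrite /head_mass big_nat_recr//=.
apply: ltr_wpDl; last exact: mu_gt0.
rewrite big_nat; apply: sumr_ge0 => j /andP[_ jn].
by apply/ltW/mu_gt0; exact: states_le Nn (ltnW jn).
Qed.

Lemma tail_resistance_gt0 (n M : nat) :
  states N M -> (n <= M)%N -> 0 < tail_resistance n M.
Proof.
move=> NM nM; rewrite /tail_resistance big_nat_recr//=.
apply: ltr_wpDl; last exact: resistance_gt0.
rewrite big_nat; apply: sumr_ge0 => k /andP[_ kM].
by apply/ltW/resistance_gt0; exact: states_le NM (ltnW kM).
Qed.

(** With [delta_le], this identifies delta as a supremum over finite windows n <= M, so that both
    bounds can be proved on finite segments. *)
Lemma le_delta (n M : nat) : states N M -> (n <= M)%N ->
  ((head_mass n * tail_resistance n M)%:E <= delta N a b)%E.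
Proof.
move=> NM nM; have Nn := states_le _ _ _ NM nM.
apply: (@le_trans _ _ ((head_mass n)%:E *
  \esum_(k in [set k | states N k /\ (n <= k)%N]) ((b k * mu a b k)^-1)%:E)%E).
  rewrite EFinM; apply: lee_wpmul2l.
    by rewrite lee_fin ltW ?head_mass_gt0.
  by apply: le_esum_tail => // i Ni; exact/ltW/resistance_gt0.
by apply: ereal_sup_ubound; exists n.
Qed.

Lemma delta_le (z : \bar R) :
  (forall n M, states N M -> (n <= M)%N ->
     ((head_mass n * tail_resistance n M)%:E <= z)%E) ->
  (delta N a b <= z)%E.
Proof.
move=> ABz; apply: ge_ereal_sup => _ [n Nn <-].
have A0 := head_mass_gt0 _ Nn.
rewrite -/(head_mass n) -lee_pdivlMl//; apply: esum_tail_le => //.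
  by move=> i Ni; exact/ltW/resistance_gt0.
by move=> M NM nM; rewrite lee_pdivlMl// -EFinM; exact: ABz.
Qed.

Lemma delta_gt0 : (0 < delta N a b)%E.
Proof.
have N0 : states N 0 by case: N.
apply: lt_le_trans (le_delta 0 0 N0 (leqnn 0)).
by rewrite lte_fin mulr_gt0 ?head_mass_gt0 ?tail_resistance_gt0.
Qed.

Lemma lambda0_ge0 : (0 <= lambda0 N a b)%E.
Proof. by apply: le_lambda0 => f M NM _; rewrite mul0r energy_ge0. Qed.

Lemma delta_le_inv_lambda0 : (delta N a b <= (lambda0 N a b)^-1)%E.
Proof.
apply: delta_le => n M NM nM.
have A0 := head_mass_gt0 _ (states_le _ _ _ NM nM).
have B0 := tail_resistance_gt0 _ _ NM nM.
pose f i := tail_resistance (maxn i n) M.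
have [|i /= iM|//|//|mass_f energy_f] :=
    @tail_test_function _ (mu a b) (fun i => mu a b i * b i) f M.+1 n.
- by move=> i iM; apply: mu_gt0; exact: states_le NM iM.
- by apply: rate_gt0; exact: states_le NM iM.
- by move=> i; apply: eq_bigr => j _; rewrite mulrC.
rewrite -/(mass f M) -/(head_mass n) /f maxnn in mass_f.
rewrite -/(energy f M) /f maxnn in energy_f.
have m0 : 0 < mass f M.
  by apply: lt_le_trans mass_f; rewrite mulr_gt0// exprn_gt0.
have fM i : (M < i)%N -> f i = 0.
  by move=> Mi; rewrite /f /tail_resistance big_geq// leq_max Mi.
have AB0 : 0 < head_mass n * tail_resistance n M by rewrite mulr_gt0.
rewrite inve_pge ?inE ?lambda0_ge0 ?lee_fin ?(ltW AB0)//.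
apply: (le_trans (lambda0_le _ _ NM fM m0)).
(* The Rayleigh quotient is at most B / (A B ^ 2) = 1 / (A B). *)
rewrite inver gt_eqF// lee_fin energy_f ler_pdivrMr//.
rewrite -ler_pdivrMl ?invr_gt0 ?mulr_gt0// invrK.
by rewrite -mulrA -expr2.
Qed.

Lemma inv_delta_le_lambda0 : ((4%:E * delta N a b)^-1 <= lambda0 N a b)%E.
Proof.
have := delta_gt0; have := @le_delta; case: (delta N a b) => [d| |]// ABd d0.
  rewrite lte_fin in d0.
  rewrite -EFinM inver gt_eqF ?mulr_gt0//; apply: le_lambda0 => f M NM fM.
  rewrite ler_pdivrMl ?mulr_gt0//.
  apply: (@hardy _ _ (fun i => mu a b i * b i)) => [i iM|i iM|k kM|].
  - by apply: mu_gt0; exact: states_le NM iM.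
  - by apply: rate_gt0; exact: states_le NM iM.
  - under [X in _ * X]eq_bigr do rewrite mulrC.
    by rewrite -lee_fin; exact: ABd.
  - exact: fM.
(* If delta is infinite, the left side is 1/oo = 0. *)
by rewrite gt0_muley ?lte_fin// invey lambda0_ge0.
Qed.

Lemma lambda0_gt0P : (0 < lambda0 N a b <-> delta N a b < +oo)%E.
Proof.
split=> [l0|d_fin].
  apply: le_lt_trans delta_le_inv_lambda0 _; rewrite ltey inve_eqy.
  by rewrite gt_eqF.
apply: lt_le_trans inv_delta_le_lambda0.
have := delta_gt0; case: (delta N a b) d_fin => [d| |]// _ d0.
rewrite lte_fin in d0.
by rewrite -EFinM inver gt_eqF ?lte_fin ?invr_gt0 mulr_gt0.
Qed.

End birth_death.

(** * Recurrence and explosion *)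

(** Take n = 0 in the supremum: since mu_0 = 1, the products there are the partial sums of the
    divergent series. *)
Lemma recurrent_delta (R : realType) (a b : nat -> R) :
  bd_rates None a b -> recurrent a b -> delta None a b = +oo%E.
Proof.
move=> rates rec; apply/eqP; rewrite -leye_eq -rec.
apply: lime_le.
  apply: is_cvg_nneseries => n _ _.
  by rewrite lee_fin invr_ge0 ltW// (rate_gt0 _ None a).
apply: nearW => m; apply: le_trans (le_delta _ _ _ _ rates 0 m _ _) => //.
have v0 k : 0 <= (b k * mu a b k)^-1.
  by apply/ltW/(resistance_gt0 _ None).
have -> : head_mass _ a b 0 = 1.
  by rewrite /head_mass big_nat1 /mu !big_geq// invr1 mulr1.
rewrite mul1r sumEFin lee_fin.
rewrite /tail_resistance.
under eq_bigr do rewrite mulrC.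
(* The partial sum runs over 1 <= k < m and the window over 0 <= k <= m, so the window has the extra
   nonnegative terms k = 0 and k = m. *)
have [m1|m0] := leqP 1 m; last by rewrite big_geq ?sumr_ge0// ltnW.
by rewrite [leRHS]big_ltn// [in leRHS]big_nat_recr//= addrCA lerDl addr_ge0.
Qed.

(** For k >= n, A_n <= A_k, so each A_n B_n is bounded by the part of the explosion series from n
    on. *)
Lemma explosive_delta (R : realType) (a b : nat -> R) :
  bd_rates None a b -> explosive a b -> (delta None a b < +oo)%E.
Proof.
move=> rates; apply: le_lt_trans; apply: delta_le => // n M NM nM.
have A0 k : 0 <= head_mass _ a b k by apply/ltW/(head_mass_gt0 _ None).
have v0 k : 0 <= (b k * mu a b k)^-1 by apply/ltW/(resistance_gt0 _ None).
apply: le_trans (nneseries_lim_ge M.+1 _); last first.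
  by move=> k _ _; rewrite lee_fin mulr_ge0// -/(head_mass _ a b k).
rewrite sumEFin lee_fin [leRHS](big_cat_nat (n := n))//= ?leqW//.
rewrite -[leLHS]add0r lerD ?sumr_ge0//.
  by move=> k _; rewrite mulr_ge0// -/(head_mass _ a b k).
rewrite mulr_sumr; apply: ler_sum_nat => k /andP[nk _].
rewrite mulrC ler_wpM2l// [leRHS](big_cat_nat (n := n.+1))//= lerDl.
by apply: sumr_ge0 => j _; apply/ltW/(mu_gt0 _ None).
Qed.

Local Open Scope ereal_scope.

Theorem theorem3p1 (R : realType) (N : option nat) (a b : nat -> R)
    (N_ge1 : if N is Some n then (1 <= n)%N else true)
    (rates : bd_rates N a b) :
  [/\ 0 < lambda0 N a b <-> delta N a b < +oo,
      (4%:E * delta N a b)^-1 <= lambda0 N a b <= (delta N a b)^-1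
    & N = None ->
        (recurrent a b -> lambda0 N a b = 0) /\
        (explosive a b -> 0 < lambda0 N a b)].
Proof.
have upper : lambda0 N a b <= (delta N a b)^-1.
  rewrite inve_pge ?inE ?lambda0_ge0 ?(ltW (delta_gt0 _ _ _ _ rates))//.
  exact: delta_le_inv_lambda0.
split; first exact: lambda0_gt0P.
- by rewrite inv_delta_le_lambda0.
- move=> NE; subst N; split=> [rec|expl].
    apply/eqP; rewrite eq_le lambda0_ge0// andbT.
    (* With delta infinite, the upper bound becomes 1/oo = 0. *)
    by rewrite recurrent_delta// invey in upper.
  by apply/lambda0_gt0P => //; exact: explosive_delta.
Qed.
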